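(* Let $A$ be a finite alphabet of cardinality $\ell$ and let $\mathbf{x}$ be an $\ell$-strict episturmian sequence over $A$. Then for all $n\ge 0$, \[ r_{\mathbf{x}}(n) = (\ell-1) \left\lfloor \frac{n+1}{2} \right\rfloor + 1. \]
   Context: A factor of a sequence is a finite contiguous block. For a finite word $u=u(1)\cdots u(m)$, its reversal is $u^R=u(m)\cdots u(1)$; $u$ and $v$ are reflectively equivalent if $v=u$ or $v=u^R$. The reflection complexity $r_{\mathbf{x}}(n)$ is the number of distinct length-$n$ factors of $\mathbf{x}$ up to reflective equivalence. A sequence is reversal-closed if for every factor $w$, $w^R$ is also a factor. A factor $u$ is left special if $au$ and $bu$ are factors for some distinct letters $a,b$. A sequence over $A$ is episturmian if it is reversal-closed and has at most one left special factor of each length. An episturmian sequence over $A$ with $|A|=\ell$ is $\ell$-strict if it has exactly one left special factor of each length and every left special factor $u$ has $\ell$ distinct left extensions $au$ ($a\in A$) that are factors. *)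

(* Defs.v *)
From mathcomp Require Import all_boot.
From mathcomp Require Import boolp.

Set Implicit Arguments.
Unset Strict Implicit.
Unset Printing Implicit Defensive.

(* An infinite sequence over A is a function x : nat -> A. *)

Definition factor (A : finType) (x : nat -> A) (u : seq A) : Prop :=
  exists i, u = [seq x (i + k) | k <- iota 0 (size u)].

Definition refl_equiv (A : finType) (u v : seq A) : bool :=
  (v == u) || (v == rev u).

Lemma refl_equivP (A : finType) : equivalence_rel (@refl_equiv A).
Proof.
move=> u v w; split=> [|/orP[] /eqP ->]; first by rewrite /refl_equiv eqxx.
  by [].
by rewrite /refl_equiv revK orbC.
Qed.

(* Being a factor is not decidable, whence the classical reflection `[< _ >]. *)
Definition factors_of_length (A : finType) (x : nat -> A) (n : nat) :
  {set n.-tuple A} := [set w : n.-tuple A | `[< factor x w >]].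

Definition reflection_complexity (A : finType) (x : nat -> A) (n : nat) : nat :=
  #|equivalence_partition (fun u v : n.-tuple A => refl_equiv u v)
      (factors_of_length x n)|.

Definition reversal_closed (A : finType) (x : nat -> A) : Prop :=
  forall w, factor x w -> factor x (rev w).

Definition left_special (A : finType) (x : nat -> A) (u : seq A) : Prop :=
  factor x u /\
  exists a b : A, [/\ a <> b, factor x (a :: u) & factor x (b :: u)].

Definition episturmian (A : finType) (x : nat -> A) : Prop :=
  reversal_closed x /\
  forall u v, left_special x u -> left_special x v -> size u = size v -> u = v.

Definition left_extensions (A : finType) (x : nat -> A) (u : seq A) : {set A} :=
  [set a : A | `[< factor x (a :: u) >]].

(* For a sequence over A, meaningful when #|A| = l. *)
Definition strict_episturmian (A : finType) (l : nat) (x : nat -> A) : Prop :=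
  [/\ episturmian x,
      forall n, exists! u : seq A, size u = n /\ left_special x u &
      forall u, left_special x u -> #|left_extensions x u| = l].

(* Main.v *)
Require Import Defs.
From mathcomp Require Import all_boot.
From mathcomp Require Import boolp zify.

(** Reflection classes have one element at a palindrome and two elsewhere, so
    twice the reflection complexity is the number of factors plus the number of
    palindromic factors.  A length-[n] factor has one left extension, except the
    left special one, which has [l]: there are [(l - 1) * n + 1] factors of
    length [n].  Each palindromic factor [p] has exactly one extension [a p a]
    that is a factor, so there are [1] or [l] palindromic factors of length [n]
    according to the parity of [n]. *)

(** The weight [1 + (f u == u)] sums to 2 over each class [{u, f u}]: a fixed point contributes 2,
    and two distinct elements contribute 1 each. *)
Lemma card_involution_classes (T : finType) (f : T -> T) (D : {set T}) :
    involutive f -> {in D, forall u, f u \in D} ->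
  2 * #|equivalence_partition (fun u v => (v == u) || (v == f u)) D| =
  #|D| + #|[set u in D | f u == u]|.
Proof.
move=> fK fD; set R := fun u v => _.
have eqR : {in D & &, equivalence_rel R}.
  move=> u v w _ _ _; rewrite /R eqxx; split=> // /orP[] /eqP-> //.
  by rewrite fK orbC.
have partD := equivalence_partitionP eqR.
have -> : #|D| + #|[set u in D | f u == u]| = \sum_(u in D) (1 + (f u == u)).
  by rewrite big_split sum1_card -sum1dep_card big_mkcondr; congr (_ + _).
rewrite [RHS](set_partition_big _ partD) /= -sum1_card big_distrr /=.
apply: eq_bigr => B /imsetP[u uD ->].
rewrite (eq_bigl (mem [set u; f u])) => [|v]; last first.
  rewrite !inE /R; case: eqP => [->|_] /=; first by rewrite uD.
  by case: eqP => [->|]; rewrite ?fD ?andbF.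
case: (eqVneq (f u) u) => fu; first by rewrite !fu setUid big_set1 fu eqxx.
by rewrite big_setU1 ?inE 1?(eq_sym u) //= big_set1 fK (eq_sym u) (negPf fu).
Qed.

(** Used for one-sided extensions [a u] when counting factors, and for two-sided extensions [a u a]
    when counting palindromes. *)
Lemma card_extensions (A T T' : finType) (g : A -> T -> T')
    (S : {set T}) (S' : {set T'}) :
    injective2 g ->
    {in S', forall w, exists a, exists2 u, u \in S & w = g a u} ->
  #|S'| = \sum_(u in S) #|[set a | g a u \in S']|.
Proof.
move=> g_inj S'g.
pose D := [set p : T * A | (p.1 \in S) && (g p.2 p.1 \in S')].
have DS' : S' = [set g p.2 p.1 | p in D].
  apply/setP=> w; apply/idP/imsetP => [wS'|[[u a]]]; last first.
    by rewrite inE /= => /andP[_ uS'] ->.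
  have [a [u uS Dw]] := S'g w wS'.
  by exists (u, a); rewrite // inE /= uS -Dw.
rewrite {1}DS' card_imset => [|[u a] [v b] /g_inj[/= -> ->] //].
rewrite -sum1dep_card -(pair_big_dep (mem S) (fun u a => g a u \in S')
  (fun _ _ => 1)) /=.
by apply: eq_bigr => u _; rewrite sum1dep_card.
Qed.

Section Factors.
Variables (A : finType) (x : nat -> A).
Implicit Types (u v : seq A) (a b c : A).

Lemma factor_cat u v : factor x (u ++ v) -> factor x u /\ factor x v.
Proof.
case=> i; rewrite size_cat iotaD map_cat add0n; move/eqP.
rewrite eqseq_cat ?size_map ?size_iota // => /andP[/eqP Du /eqP Dv].
split; first by exists i.
exists (i + size u); rewrite {1}Dv -[X in iota X]addn0 iotaDl.
by rewrite -map_comp; apply: eq_map => k /=; rewrite addnA.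
Qed.

Lemma factor_behead a u : factor x (a :: u) -> factor x u.
Proof. by rewrite -cat1s => /factor_cat[]. Qed.

Lemma factor_belast u a : factor x (rcons u a) -> factor x u.
Proof. by rewrite -cats1 => /factor_cat[]. Qed.

Lemma factor_right_ext u : factor x u -> exists a, factor x (rcons u a).
Proof.
case=> i Du; exists (x (i + size u)), i.
by rewrite size_rcons -addn1 iotaD map_cat add0n -Du cats1.
Qed.

Section StrictEpisturmian.
Variable l : nat.
Hypotheses (cardA : #|A| = l) (hx : strict_episturmian l x).

Lemma factor_rev u : factor x u -> factor x (rev u).
Proof. by case: hx => -[+ _] _ _; apply. Qed.

(** An occurrence at position 0 has no letter before it, so the right extension of the reversal is
    reversed instead. *)
Lemma factor_left_ext u : factor x u -> exists a, factor x (a :: u).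
Proof.
move=> /factor_rev/factor_right_ext[a /factor_rev].
by rewrite rev_rcons revK; exists a.
Qed.

Lemma left_special_ext u a : left_special x u -> factor x (a :: u).
Proof.
case: hx => _ _ ext /ext extl.
have /eqP extT : left_extensions x u == setT.
  by rewrite eqEcard subsetT cardsT cardA extl leqnn.
by have := in_setT a; rewrite -extT inE => /asboolP.
Qed.

Lemma left_ext_unique u a b : ~ left_special x u ->
  factor x (a :: u) -> factor x (b :: u) -> a = b.
Proof.
move=> nsu au bu; apply: contrapT => nab; apply: nsu.
by split; [apply: factor_behead au | exists a, b].
Qed.

Lemma left_special_belast u a : left_special x (rcons u a) -> left_special x u.
Proof.
case=> uaF [b [c [nbc bF cF]]]; split; first exact: factor_belast uaF.
by exists b, c; split=> //; apply: (factor_belast _ a); rewrite rcons_cons.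
Qed.

Lemma left_special_exists n : exists2 u, size u = n & left_special x u.
Proof. by case: hx => _ /(_ n)[u [[? ?] _]] _; exists u. Qed.

Lemma left_special_unique u v :
  left_special x u -> left_special x v -> size u = size v -> u = v.
Proof. by case: hx => -[_ + _ _]; apply. Qed.

(** The left special factor of length 0 is the empty word, and every letter extends it. *)
Lemma letter_factor a : factor x [:: a].
Proof.
have [u /size0nil-> sp0] := left_special_exists 0.
exact: left_special_ext sp0.
Qed.

Lemma palindrome_ext p : factor x p -> rev p = p ->
  exists a, forall b, factor x (b :: rcons p b) <-> b = a.
Proof.
move=> pF pal.
have swap b c : factor x (b :: rcons p c) -> factor x (c :: rcons p b).
  by move=> /factor_rev; rewrite rev_cons rev_rcons pal.
case: (pselect (left_special x p)) => [sp|nsp].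
  (* The left special factor one letter longer is [p a]; all [b p a] are
     factors, hence so are all [a p b], while [p b] has no other left
     extension when [b <> a]. *)
  have [u] := left_special_exists (size p).+1.
  case/lastP: u => // q a; rewrite size_rcons => -[szq] sqa.
  have Dq : q = p.
    exact: left_special_unique (left_special_belast _ _ sqa) sp szq.
  rewrite {q szq}Dq in sqa.
  exists a => b; split=> [bb|->]; last exact: left_special_ext.
  apply: contrapT => nba; have := left_special_ext _ b sqa => /swap ab.
  apply: (nba); apply: left_ext_unique bb ab => spb.
  have /rcons_inj[] : rcons p b = rcons p a.
    by apply: left_special_unique; rewrite ?size_rcons.
  exact: nba.
(* Here [a] is the only left extension of [p]. If [c] extends [a p] to the right, reversing [a p c]
   gives [c p a], which forces [c = a]. *)
have [a ap] := factor_left_ext _ pF.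
have ext b c : factor x (b :: rcons p c) -> b = a.
  by rewrite -rcons_cons => /factor_belast bp; apply: left_ext_unique bp ap.
exists a => b; split=> [/ext //|->].
have [c] := factor_right_ext _ ap; rewrite rcons_cons => apc.
by rewrite -{2}(ext _ _ (swap _ _ apc)).
Qed.

Lemma card_factors n : #|factors_of_length x n| = (l - 1) * n + 1.
Proof.
elim: n => [|n IHn].
  rewrite muln0 -[RHS]/(#|A| ^ 0) -card_tuple -cardsT; apply: eq_card => w.
  by rewrite !inE tuple0; apply/asboolP; exists 0.
rewrite (@card_extensions _ _ _ (fun a (u : n.-tuple A) => [tuple of a :: u])
  (factors_of_length x n)); first last.
- move=> w; rewrite inE => /asboolP; case/tupleP: w => a u auF.
  by exists a, u; rewrite // inE; apply/asboolP/(factor_behead a).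
- by move=> a b u v /(congr1 val)[-> /val_inj].
have [s szs sps] := left_special_exists n.
pose t := tcast szs (in_tuple s).
have Dt : t = s :> seq A by rewrite val_tcast.
have tF : t \in factors_of_length x n.
  by rewrite inE Dt; apply/asboolP; case: sps.
have cardE (u : n.-tuple A) :
    #|[set a | [tuple of a :: u] \in factors_of_length x n.+1]| =
    #|left_extensions x u|.
  by apply: eq_card => a; rewrite !inE.
under eq_bigr => u _ do rewrite cardE.
(* The left special [t] contributes [l] and each of the other [(l - 1) * n] factors contributes
   1. *)
rewrite (bigD1 t) //=; under eq_bigr => u /andP[uF nut].
  have -> : #|left_extensions x u| = 1.
    move: uF; rewrite inE => /asboolP/factor_left_ext[a au].
    apply/eqP/cards1P; exists a; apply/setP=> b; rewrite !inE.
    apply/asboolP/eqP => [bu|->//]; apply: left_ext_unique bu au => su.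
    case/eqP: nut; apply/val_inj; rewrite /= Dt.
    by apply: left_special_unique; rewrite // size_tuple.
  over.
rewrite sum1dep_card Dt.
have -> : #|left_extensions x s| = l by case: hx => _ _; apply.
have := cardsD1 t (factors_of_length x n).
rewrite tF IHn addnC => /(@addnI 1) Fn.
have -> : #|[set u in factors_of_length x n | u != t]| =
          #|factors_of_length x n :\ t|.
  by apply: eq_card => u; rewrite !inE andbC.
rewrite -Fn; have [a _] : exists a, factor x (a :: s).
  by apply: factor_left_ext; case: sps.
(* Positivity makes the truncated [l - 1] a true difference. *)
have l_gt0 : 0 < l by rewrite -cardA; apply/card_gt0P; exists a.
by rewrite mulnS -{1}(subnK l_gt0) addnAC.
Qed.

Definition palindromes n :=
  [set w in factors_of_length x n | [tuple of rev w] == w].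

Lemma in_palindromes n (w : n.-tuple A) :
  reflect (factor x w /\ rev w = w) (w \in palindromes n).
Proof.
rewrite !inE; apply: (iffP andP) => [[/asboolP wF /eqP/(congr1 val)] //|].
by case=> wF wpal; split; [apply/asboolP | apply/eqP/val_inj].
Qed.

(** Stripping both end letters of a palindromic factor leaves one, and [palindrome_ext] gives
    exactly one way back. *)
Lemma card_palindromesSS n : #|palindromes n.+2| = #|palindromes n|.
Proof.
rewrite (@card_extensions _ _ _
  (fun a (u : n.-tuple A) => [tuple of a :: rcons u a]) (palindromes n)).
- rewrite -sum1_card; apply: eq_bigr => p /in_palindromes[pF pal].
  have [a aP] := palindrome_ext _ pF pal.
  apply/eqP/cards1P; exists a; apply/setP=> b; rewrite in_set in_set1.
  apply/in_palindromes/eqP => [[/aP] //|/aP bF]; split=> //=.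
  by rewrite rev_cons rev_rcons pal.
- by move=> a b u v /(congr1 val)[-> /rcons_inj[/val_inj]].
move=> w /in_palindromes[]; case/tupleP: w => a w /=.
case: w => w szw /=; case/lastP: w szw => // w b szw.
rewrite rev_cons rev_rcons => awF [Db] /rcons_inj[pal _]; subst b.
have szw' : size w == n by rewrite size_rcons in szw.
exists a, (Tuple szw'); last exact/val_inj.
apply/in_palindromes; split=> //=.
exact/(factor_belast _ a)/(factor_behead a).
Qed.

(** The recursion by steps of two starts at lengths 0 and 1, where every word is a palindromic
    factor: [#|A| ^ 0] and [#|A| ^ 1] of them. *)
Lemma card_palindromes n : #|palindromes n| = if odd n then l else 1.
Proof.
elim/ltn_ind: n => -[|[|n]] IHn.
- rewrite -[RHS]/(#|A| ^ 0) -card_tuple -cardsT; apply: eq_card => w.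
  by rewrite [RHS]inE tuple0; apply/in_palindromes; split=> //; exists 0.
- rewrite -[RHS]cardA -[RHS]expn1 -(card_tuple 1 A) -cardsT.
  apply: eq_card => w; rewrite [RHS]inE; apply/in_palindromes.
  by case/tupleP: w => a w; rewrite tuple0; split; [apply: letter_factor|].
- by rewrite card_palindromesSS IHn //= negbK.
Qed.

End StrictEpisturmian.
End Factors.

Theorem theorem6p5 (A : finType) (l : nat) (cardA : #|A| = l) (x : nat -> A)
    (hx : strict_episturmian l x) (n : nat) :
  reflection_complexity x n = (l - 1) * ((n + 1) %/ 2) + 1.
Proof.
have l_gt0 : 0 < l.
  by rewrite -cardA; apply/card_gt0P; exists (x 0).
pose rv (w : n.-tuple A) : n.-tuple A := [tuple of rev w].
have rvK : involutive rv by move=> w; apply/val_inj; rewrite /= revK.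
have rvF : {in factors_of_length x n, forall w, rv w \in factors_of_length x n}.
  move=> w; rewrite in_set => /asboolP wF; rewrite in_set.
  exact/asboolP/(factor_rev _ _ _ hx).
apply/eqP; rewrite -(eqn_pmul2l (isT : 0 < 2)); apply/eqP.
have := card_involution_classes _ _ _ rvK rvF.
rewrite -/(palindromes _ _ n) (card_factors _ _ _ cardA hx).
rewrite (card_palindromes _ _ _ cardA hx) => Dr; rewrite [LHS]Dr.
(* With [m = n./2], the doubled count is [(l - 1) * 2m + 1 + 1] for even [n] and [(l - 1) * (2m + 1)
   + 1 + l = (l - 1) * (2m + 2) + 2] for odd [n]. *)
rewrite [n + 1]addn1 divn2 -uphalfE uphalf_half -{1}[n]odd_double_half.
by case: (odd n); nia.
Qed.
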